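(* The generating functions for partitions with respect to the statistic $\mathrm{ds}_{\ulcorner}$ (the number of self-conjugate diagonal hooks) and the side length of any (in the first formula) or the smallest (in the second formula) square containing their Young diagram are $$\sum_{n\ge0} \sum_{\lambda\in\mathcal P^\Box_n} s^{\mathrm{ds}_{\ulcorner}(\lambda)} z^n = \frac{1}{(1-s)z + \sqrt{1-4z}},$$ $$\sum_{\lambda\in\mathcal P} s^{\mathrm{ds}_{\ulcorner}(\lambda)} z^{\max\{\lambda_1,\lambda'_1\}} = \frac{1-z}{(1-s)z + \sqrt{1-4z}}.$$
   Context: $\mathcal P$ is the set of all integer partitions, i.e. sequences $\lambda=(\lambda_1,\dots,\lambda_k)$ with $k\ge0$ and $\lambda_1\ge\dots\ge\lambda_k\ge1$ (including the empty partition, for which $\lambda_1=\lambda_1'=0$). $\lambda'$ is the conjugate partition, with $\lambda'_i=|\{j:\lambda_j\ge i\}|$; $\lambda_1'$ is the number of parts of $\lambda$. For $n\ge0$, $\mathcal P^\Box_n$ is the set of partitions with $k\le n$ parts and $\lambda_1\le n$. The boxes of the Young diagram of $\lambda$ decompose into diagonal hooks: the first hook consists of the first row and the first column; the second hook is the largest hook (first row and first column) after the first hook has been removed, and so on; the number of hooks is the largest $\delta$ with $\lambda_\delta\ge\delta$. The statistic $\mathrm{ds}_{\ulcorner}(\lambda)$ is the number of these diagonal hooks that are self-conjugate, i.e. have the same number of boxes in their row as in their column (equivalently, the number of $i\le\delta$ with $\lambda_i=\lambda'_i$). The identities are between formal power series in $z$ with coefficients polynomials in $s$, with $\sqrt{1-4z}$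 having constant term $1$. *)

(* Defs.v *)
From HB Require Import structures.
From mathcomp Require Import all_boot all_order all_algebra.
From mathcomp Require Import boolp classical_sets functions cardinality fsbigop.

Set Implicit Arguments.
Unset Strict Implicit.
Unset Printing Implicit Defensive.

Import GRing.Theory.

Local Open Scope ring_scope.

(* Formal power series.  A record rather than a bare [nat -> R], because      *)
(* MathComp-Analysis equips function types with the pointwise product.        *)

Record fps (R : Type) := Fps { fps_coef :> nat -> R }.

HB.instance Definition _ (R : Type) := gen_eqMixin (fps R).
HB.instance Definition _ (R : Type) := gen_choiceMixin (fps R).

Lemma fpsP (R : Type) (f g : fps R) : f =1 g -> f = g.
Proof. by case: f g => [f] [g] /= /funext ->. Qed.

Definition fps_zero (R : zmodType) : fps R := Fps (fun=> 0).
Definition fps_opp (R : zmodType) (f : fps R) : fps R := Fps (fun n => - f n).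
Definition fps_add (R : zmodType) (f g : fps R) : fps R :=
  Fps (fun n => f n + g n).

Fact fps_addA (R : zmodType) : associative (@fps_add R).
Proof. by move=> f g h; apply/fpsP=> n /=; rewrite addrA. Qed.
Fact fps_addC (R : zmodType) : commutative (@fps_add R).
Proof. by move=> f g; apply/fpsP=> n /=; rewrite addrC. Qed.
Fact fps_add0 (R : zmodType) : left_id (@fps_zero R) (@fps_add R).
Proof. by move=> f; apply/fpsP=> n /=; rewrite add0r. Qed.
Fact fps_addN (R : zmodType) :
  left_inverse (@fps_zero R) (@fps_opp R) (@fps_add R).
Proof. by move=> f; apply/fpsP=> n /=; rewrite addNr. Qed.

HB.instance Definition _ (R : zmodType) := GRing.isZmodule.Build (fps R)
  (@fps_addA R) (@fps_addC R) (@fps_add0 R) (@fps_addN R).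

Lemma fps_coefD (R : zmodType) (f g : fps R) (n : nat) :
  (f + g) n = f n + g n.
Proof. by []. Qed.

Lemma fps_coefN (R : zmodType) (f : fps R) (n : nat) : (- f) n = - f n.
Proof. by []. Qed.

Definition fpsC (R : zmodType) (c : R) : fps R :=
  Fps (fun n => if n == 0%N then c else 0).
Definition fps_mul (R : comNzRingType) (f g : fps R) : fps R :=
  Fps (fun n => \sum_(i < n.+1) f i * g (n - i)%N).

Definition fps_trunc (R : comNzRingType) (m : nat) (f : fps R) : {poly R} :=
  \poly_(i < m) f i.

Lemma fps_mul_trunc (R : comNzRingType) (f g : fps R) (m n : nat) :
  (n < m)%N -> fps_mul f g n = (fps_trunc m f * fps_trunc m g)`_n.
Proof.
move=> lt_nm; rewrite coefM /=; apply: eq_bigr => i _.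
rewrite !coef_poly (leq_ltn_trans _ lt_nm) ?leq_ord //.
by rewrite (leq_ltn_trans _ lt_nm) ?leq_subr.
Qed.

Fact fps_mulC (R : comNzRingType) : commutative (@fps_mul R).
Proof.
by move=> f g; apply/fpsP=> n; rewrite !(@fps_mul_trunc _ _ _ n.+1) // mulrC.
Qed.

Fact fps_mulA (R : comNzRingType) : associative (@fps_mul R).
Proof.
move=> f g h; apply/fpsP=> n; pose t := @fps_trunc R n.+1.
transitivity ((t f * (t g * t h))`_n).
  rewrite coefM; apply: eq_bigr => i _.
  rewrite coef_poly ltn_ord; congr (_ * _).
  by rewrite (@fps_mul_trunc _ _ _ n.+1) ?ltnS ?leq_subr.
rewrite mulrA coefM; apply: eq_bigr => i _.
by rewrite [X in _ * X]coef_poly ltnS leq_subr -fps_mul_trunc // ltnW ?ltnS.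
Qed.

Fact fps_mul1 (R : comNzRingType) : left_id (fpsC (1 : R)) (@fps_mul R).
Proof.
move=> f; apply/fpsP=> n /=; rewrite big_ord_recl /= mul1r subn0 big1 ?addr0 //.
by move=> i _; rewrite mul0r.
Qed.

Fact fps_mulDl (R : comNzRingType) :
  left_distributive (@fps_mul R) (@fps_add R).
Proof.
move=> f g h; apply/fpsP=> n /=; rewrite -big_split /=.
by apply: eq_bigr => i _; rewrite mulrDl.
Qed.

Fact fps_1neq0 (R : comNzRingType) : fpsC (1 : R) != 0.
Proof.
apply/eqP=> /(congr1 (fun f : fps R => f 0%N)) /= /eqP; by rewrite oner_eq0.
Qed.

HB.instance Definition _ (R : comNzRingType) :=
  GRing.Zmodule_isComNzRing.Build (fps R) (@fps_mulA R) (@fps_mulC R)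
    (@fps_mul1 R) (@fps_mulDl R) (@fps_1neq0 R).

Lemma fps_coefM (R : comNzRingType) (f g : fps R) (n : nat) :
  (f * g) n = \sum_(i < n.+1) f i * g (n - i)%N.
Proof. by []. Qed.

Lemma fps_coefM0 (R : comNzRingType) (f g : fps R) :
  (f * g) 0%N = f 0%N * g 0%N.
Proof. by rewrite fps_coefM big_ord1. Qed.

Lemma fps_coef1 (R : comNzRingType) (n : nat) :
  (1 : fps R) n = (n == 0%N)%:R.
Proof. by rewrite /=; case: eqP. Qed.

(* Sequences defined by course-of-values recursion, [step n s] giving the     *)
(* n-th term from the list [s] of the previous ones.                          *)

Fixpoint cov_seq (R : Type) (step : nat -> seq R -> R) (n : nat) : seq R :=
  if n is m.+1 then rcons (cov_seq step m) (step m (cov_seq step m)) else [::].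

Definition cov (R : Type) (step : nat -> seq R -> R) (n : nat) : R :=
  step n (cov_seq step n).

Lemma size_cov_seq (R : Type) (step : nat -> seq R -> R) (n : nat) :
  size (cov_seq step n) = n.
Proof. by elim: n => //= n IHn; rewrite size_rcons IHn. Qed.

Lemma nth_cov_seq (R : Type) (x0 : R) (step : nat -> seq R -> R) (n i : nat) :
  (i < n)%N -> nth x0 (cov_seq step n) i = cov step i.
Proof.
elim: n => //= n IHn; rewrite ltnS leq_eqVlt nth_rcons size_cov_seq.
by case/predU1P=> [->|lt_in]; rewrite ?ltnn ?eqxx // lt_in IHn.
Qed.

Definition fps_inv_step (R : comUnitRingType) (f : fps R)
    (n : nat) (s : seq R) : R :=
  (f 0%N)^-1 * ((n == 0%N)%:R - \sum_(i < n) s`_i * f (n - i)%N).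

Definition fps_unit (R : comUnitRingType) : {pred fps R} :=
  fun f => f 0%N \is a GRing.unit.
Definition fps_inv (R : comUnitRingType) (f : fps R) : fps R :=
  if fps_unit f then Fps (cov (fps_inv_step f)) else f.

Fact fps_mulV (R : comUnitRingType) :
  {in @fps_unit R, left_inverse 1 (@fps_inv R) *%R}.
Proof.
move=> f Uf; have Uf0 : f 0%N \is a GRing.unit by [].
rewrite /fps_inv (_ : fps_unit f = true) //; apply/fpsP=> n.
rewrite fps_coefM fps_coef1 big_ord_recr /= subnn mulrC {2}/cov.
rewrite /fps_inv_step mulVKr // addrC.
under [X in _ - X]eq_bigr => i _ do rewrite nth_cov_seq //.
by rewrite subrK.
Qed.

Fact fps_unitP (R : comUnitRingType) (f g : fps R) : g * f = 1 -> fps_unit f.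
Proof.
move=> /(congr1 (fun h : fps R => h 0%N)); rewrite fps_coefM0 => gf1.
by apply/unitrPr; exists (g 0%N); rewrite mulrC.
Qed.

Fact fps_inv_out (R : comUnitRingType) :
  {in [predC @fps_unit R], @fps_inv R =1 id}.
Proof.
move=> f /negPf nUf; have {}nUf : fps_unit f = false by [].
by rewrite /fps_inv nUf.
Qed.

HB.instance Definition _ (R : comUnitRingType) :=
  GRing.ComNzRing_hasMulInverse.Build (fps R) (@fps_mulV R) (@fps_unitP R)
    (@fps_inv_out R).

Lemma fps_unitE (R : comUnitRingType) (f : fps R) :
  (f \is a GRing.unit) = (f 0%N \is a GRing.unit).
Proof. by []. Qed.

Definition fpsX (R : comNzRingType) : fps R := Fps (fun n => (n == 1%N)%:R).

Lemma fps_coefXn (R : comNzRingType) (m n : nat) :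
  (fpsX R ^+ m) n = (n == m)%:R.
Proof.
elim: m n => [|m IHm] n; first by rewrite expr0 fps_coef1.
rewrite exprS fps_coefM; case: n => [|n]; first by rewrite big_ord1 mul0r.
rewrite big_ord_recl mul0r add0r big_ord_recl mul1r subSS subn0 IHm eqSS.
by rewrite big1 ?addr0 // => i _; rewrite mul0r.
Qed.

Lemma fps_coefCM (R : comNzRingType) (c : R) (f : fps R) (n : nat) :
  (fpsC c * f) n = c * f n.
Proof.
rewrite fps_coefM big_ord_recl subn0 big1 ?addr0 // => i _; exact: mul0r.
Qed.

(* The square root with constant term 1.                                      *)
Definition fps_sqrt (R : comNzRingType) (f : fps R) : fps R :=
  xget 0 [set r | r ^+ 2 = f /\ r 0%N = 1].

Lemma fps_sqrt_exists (R : comUnitRingType) (f : fps R) :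
    (2%:R : R) \is a GRing.unit -> f 0%N = 1 ->
  exists r : fps R, r ^+ 2 = f /\ r 0%N = 1.
Proof.
move=> U2 f0.
pose step n (s : seq R) := if n is m.+1 then
  2%:R^-1 * (f n - \sum_(i < m) s`_(i.+1) * s`_(n - i.+1)) else 1.
exists (Fps (cov step)); split=> //; apply/fpsP=> -[|n].
  by rewrite expr2 fps_coefM0 f0 mulr1.
rewrite expr2 fps_coefM big_ord_recl big_ord_recr /= subn0 /bump /= subnn.
have c0 : cov step 0 = 1 by [].
rewrite c0 mul1r mulr1 addrCA -mulr2n -[_ *+ 2]mulr_natl {2}/cov mulVKr //.
apply/eqP; rewrite addrCA -[X in _ == X]addr0 (inj_eq (addrI _)) subr_eq0.
apply/eqP/eq_bigr => i _.
by rewrite !nth_cov_seq ?ltnS ?subSS ?leq_subr // ltn_ord.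
Qed.

Lemma fps_sqrtP (R : comUnitRingType) (f : fps R) :
    (2%:R : R) \is a GRing.unit -> f 0%N = 1 ->
  fps_sqrt f ^+ 2 = f /\ fps_sqrt f 0%N = 1.
Proof.
by move=> U2 f0; apply: (xgetPex 0 (fps_sqrt_exists U2 f0)).
Qed.

Lemma fps_sqrt_unique (R : comUnitRingType) (r1 r2 : fps R) :
    (2%:R : R) \is a GRing.unit -> r1 0%N = 1 -> r2 0%N = 1 ->
  r1 ^+ 2 = r2 ^+ 2 -> r1 = r2.
Proof.
move=> U2 r1_0 r2_0 /eqP; rewrite -subr_eq0 subr_sqr => /eqP r12.
have U : r1 + r2 \is a GRing.unit by rewrite fps_unitE /= r1_0 r2_0.
by apply/eqP; rewrite -subr_eq0 -[_ - _](mulrK U) r12 mul0r.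
Qed.

(* Sum of a family of power series, coefficient by coefficient; meaningful    *)
(* when each coefficient is nonzero for finitely many members only (fsbigop   *)
(* sums over an infinite support are 0 by convention).                        *)
Definition fps_summable (R : comNzRingType) (I : choiceType)
    (F : I -> fps R) : Prop :=
  forall n : nat, finite_set [set i | F i n != 0].
Definition fps_sum (R : comNzRingType) (I : choiceType)
    (F : I -> fps R) : fps R :=
  Fps (fun n => \sum_(i \in [set: I]) F i n).

(* Integer partitions.                                                        *)

Definition is_intpart (la : seq nat) : bool :=
  sorted geq la && all (leq 1) la.

Record intpart := IntPart { parts :> seq nat; _ : is_intpart parts }.

HB.instance Definition _ := [isSub for parts].
HB.instance Definition _ := [Countable of intpart by <:].

(* The parts are numbered from 1; [part la i] is 0 past the last one.         *)
Definition part (la : intpart) (i : nat) : nat := nth 0%N la i.-1.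
Definition conj_part (la : intpart) (i : nat) : nat := count (leq i) la.

Definition boxed (n : nat) : set intpart :=
  [set la : intpart | (size la <= n)%N /\ (part la 1 <= n)%N].

Definition durfee (la : intpart) : nat :=
  \max_(1 <= i < (size la).+1 | (i <= part la i)%N) i.

(* Deletes the first row and the first column of the diagram.                 *)
Definition remove_hook (la : seq nat) : seq nat :=
  [seq x.-1 | x <- behead la & (1 < x)%N].

Definition self_conj_hook (la : seq nat) : bool := head 0%N la == size la.

(* The i-th diagonal hook, counting from 0, is the first hook of the diagram  *)
(* left after i removals.                                                     *)
Definition ds (la : intpart) : nat :=
  \sum_(i < durfee la) self_conj_hook (iter i remove_hook la).

Lemma conj_part1 (la : intpart) : conj_part la 1 = size la.
Proof.
case: la => s s_part; case/andP: (s_part) => _.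
by rewrite all_count => /eqP.
Qed.

Lemma nth_is_intpart (s : seq nat) (i j : nat) :
  is_intpart s -> (i <= j)%N -> (nth 0%N s j <= nth 0%N s i)%N.
Proof.
move=> s_part le_ij; case/andP: (s_part) => s_sorted _.
have [le_sj|lt_js] := leqP (size s) j; first by rewrite nth_default.
apply: (@sorted_leq_nth _ geq _ _ 0%N s s_sorted) => //.
- by move=> a b c /= ba ac; apply: leq_trans ac ba.
- by move=> a /=.
- by rewrite inE (leq_ltn_trans le_ij).
Qed.

Lemma is_intpart_behead (x : nat) (s : seq nat) :
  is_intpart (x :: s) -> is_intpart s.
Proof. by rewrite /is_intpart /= => /and3P[/path_sorted-> _ ->]. Qed.

Lemma remove_hook_intpart (s : seq nat) :
  is_intpart s -> is_intpart (remove_hook s).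
Proof.
case: s => //= x s /is_intpart_behead/andP[s_sorted _]; apply/andP; split.
  rewrite sorted_map; apply: (@sub_sorted _ geq).
    by move=> a b /=; rewrite -!subn1 => ba; apply: leq_sub2r.
  apply: sorted_filter => // a b c /= ba ac; exact: leq_trans ac ba.
apply/allP=> y /mapP[a]; rewrite mem_filter => /andP[a_gt1 _] ->.
by rewrite -ltnS prednK // ltnW.
Qed.

Lemma nth_remove_hook (s : seq nat) (j : nat) :
  is_intpart s -> nth 0%N (remove_hook s) j = (nth 0%N s j.+1).-1.
Proof.
case: s => [|x s] /=; first by rewrite nth_nil.
rewrite /remove_hook /= => /is_intpart_behead.
elim: s j => [|y s IHs] j /= ys; first by rewrite !nth_nil.
case: ltnP => /= [y_gt1|y_le1].
  by case: j => //= j; apply/IHs/is_intpart_behead/ys.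
rewrite (_ : [seq _ <- s | _] = [::]) ?nth_nil.
  have := nth_is_intpart ys (leq0n j) => /= /leq_trans/(_ y_le1).
  by case: nth => [|[]].
apply/eqP; rewrite -[_ == _]negbK -has_filter -all_predC.
apply/allP=> z /(nthP 0%N)[k _ <-] /=; rewrite -leqNgt.
exact: leq_trans (nth_is_intpart ys (leq0n k.+1)) y_le1.
Qed.

Lemma count_remove_hook (s : seq nat) (k : nat) : is_intpart s -> (0 < k)%N ->
  count (leq k) (remove_hook s) = (count (leq k.+1) s).-1.
Proof.
case: s => //= x s xs k_gt0.
rewrite /remove_hook /= count_map count_filter.
have -> : count [predI preim predn (leq k) & [pred y | (1 < y)%N]] s
          = count (leq k.+1) s.
  apply: eq_count => -[|[|y]]; rewrite !inE ?andbF //= ?andbT //.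
  by rewrite ltnS leqNgt k_gt0.
case: ltnP => [//|le_xk]; apply/eqP; rewrite (_ : count _ _ = 0%N) //.
apply/eqP; rewrite -leqn0 leqNgt -has_count; apply/hasPn=> z.
move=> /(nthP 0%N)[i _ <-]; rewrite -ltnNge ltnS.
exact: leq_trans (nth_is_intpart xs (leq0n i.+1)) le_xk.
Qed.

Lemma iter_remove_hook (s : seq nat) (i : nat) : is_intpart s ->
  [/\ is_intpart (iter i remove_hook s),
      forall j, nth 0%N (iter i remove_hook s) j = (nth 0%N s (i + j) - i)%N
    & forall k, (0 < k)%N -> count (leq k) (iter i remove_hook s)
                             = (count (leq (i + k)) s - i)%N].
Proof.
move=> s_part; elim: i => [|i [IH1 IH2 IH3]] /=.
  by split=> // [j|k _]; rewrite subn0.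
split=> [|j|k k_gt0]; first exact: remove_hook_intpart.
  by rewrite nth_remove_hook // IH2 -subnS addnS addSn.
by rewrite count_remove_hook // IH3 // -subnS addnS addSn.
Qed.

Lemma durfee_le (la : intpart) (i : nat) :
  (0 < i <= durfee la)%N -> (i <= part la i)%N.
Proof.
case/andP=> i_gt0 le_i; have la_part : is_intpart la by case: (la).
suff le_d : (durfee la <= part la (durfee la))%N.
  apply/(leq_trans le_i)/(leq_trans le_d)/nth_is_intpart => //.
  by rewrite -!subn1 leq_sub2r.
rewrite /durfee; elim/big_ind: _ => // a b le_a le_b.
by rewrite /maxn; case: ifP.
Qed.

Lemma durfee_max (la : intpart) (i : nat) :
  (0 < i)%N -> (i <= part la i)%N -> (i <= durfee la)%N.
Proof.
move=> i_gt0 le_i; rewrite /durfee; apply: leq_bigmax_seq => //.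
rewrite mem_index_iota i_gt0 ltnS; case: i i_gt0 le_i => // i _ le_i.
by rewrite ltnNge; apply/negP=> le_s; move: le_i; rewrite /part nth_default.
Qed.

Lemma dsE (la : intpart) :
  ds la = (\sum_(1 <= i < (durfee la).+1) (part la i == conj_part la i))%N.
Proof.
have la_part : is_intpart la by case: (la).
rewrite /ds big_add1 big_mkord; apply: eq_bigr => i _ /=; congr nat_of_bool.
have [p_i n_i c_i] := iter_remove_hook i la_part.
rewrite /self_conj_hook -nth0 n_i addn0.
rewrite (_ : size _ = count (leq 1) (iter i remove_hook la)); last first.
  by apply/esym/eqP; rewrite -all_count; case/andP: p_i.
rewrite c_i // addn1 /part /conj_part /=.
have le_i : (i < part la i.+1)%N by apply: durfee_le; rewrite ltnS leq0n ltn_ord.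
have le_c : (i < count (leq i.+1) la)%N.
  rewrite -[la : seq nat](cat_take_drop i.+1) count_cat.
  have lt_s : (i < size la)%N.
    by rewrite ltnNge; apply/negP=> /(nth_default 0%N) e; rewrite /part /= e in le_i.
  rewrite (_ : count _ (take _ _) = i.+1) ?leq_addr //.
  rewrite -[RHS](size_takel lt_s); apply/eqP; rewrite -all_count.
  apply/(all_nthP 0%N) => j; rewrite (size_takel lt_s) => lt_j.
  by rewrite nth_take //; apply: leq_trans le_i (nth_is_intpart la_part _).
by rewrite -(eqn_add2r i) !subnK // ltnW.
Qed.

Local Open Scope classical_set_scope.

Lemma finite_boxed (n : nat) : finite_set (boxed n).
Proof.
pose g (t : {bseq n of 'I_n.+1}) : seq nat := map val t.
have fin_g : finite_set (range g) by exact: finite_image.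
have parts_inj : set_inj (parts @^-1` range g) parts.
  by move=> ? ? _ _; apply: val_inj.
apply: sub_finite_set (finite_preimage parts_inj fin_g) => la [le_s le_p].
have le_sz : (size (map (@inord n) la) <= n)%N by rewrite size_map.
exists (Bseq le_sz) => //; rewrite /g /= -map_comp -[RHS]map_id.
apply/eq_in_map=> x /(nthP 0%N)[i _ <-] /=; rewrite inordK // ltnS.
by apply: leq_trans le_p; apply: nth_is_intpart => //; case: (la).
Qed.

Lemma fps_coefMXn_lt (R : comNzRingType) (f : fps R) (m n : nat) :
  (n < m)%N -> (f * fpsX R ^+ m) n = 0.
Proof.
move=> lt_nm; rewrite fps_coefM big1 // => j _; rewrite fps_coefXn.
by rewrite ltn_eqF ?mulr0 // (leq_ltn_trans _ lt_nm) ?leq_subr.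
Qed.

Lemma summable_boxed (R : comNzRingType) (a : intpart -> fps R) :
  fps_summable (fun n : nat => \sum_(la \in boxed n) a la * fpsX R ^+ n).
Proof.
move=> n; apply: (@sub_finite_set _ _ `I_n.+1); last exact: finite_II.
move=> i /=.
apply: contraNT; rewrite -leqNgt => lt_ni.
rewrite fsbig_finite; last exact: finite_boxed.
apply/eqP; apply: (big_ind (fun f : fps R => f n = 0)) => // [f g f0 g0|la _].
  by rewrite /= f0 g0 addr0.
exact: fps_coefMXn_lt.
Qed.

Lemma summable_intpart (R : comNzRingType) (a : intpart -> fps R) :
  fps_summable (fun la : intpart =>
    a la * fpsX R ^+ maxn (part la 1) (conj_part la 1)).
Proof.
move=> n; apply: (@sub_finite_set _ _ (boxed n)); last exact: finite_boxed.
move=> la /=.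
rewrite conj_part1 => nz.
have [lt_n|le_n] := ltnP n (maxn (part la 1) (size la)).
  by case/eqP: nz; exact: fps_coefMXn_lt.
by split; apply: leq_trans le_n; rewrite ?leq_maxl ?leq_maxr.
Qed.

Lemma denominator_unit (R : comUnitRingType) (s : R) :
    (2%:R : R) \is a GRing.unit ->
  (1 - fpsC s) * fpsX R + fps_sqrt (1 - 4%:R * fpsX R) \is a GRing.unit.
Proof.
move=> U2; set f := 1 - 4%:R * _; have f0 : f 0%N = 1.
  by rewrite fps_coefD fps_coefN fps_coefM0 mulr0 subr0.
have [_ r0] := fps_sqrtP U2 f0; rewrite fps_unitE.
by rewrite fps_coefD fps_coefM0 mulr0 add0r r0 unitr1.
Qed.

(* Main.v *)
Require Import Defs.
From mathcomp Require Import all_boot all_order all_algebra.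
From mathcomp Require Import boolp classical_sets functions cardinality fsbigop.
From mathcomp Require Import zify ring.

Set Implicit Arguments.
Unset Strict Implicit.
Unset Printing Implicit Defensive.

Import GRing.Theory.
Local Open Scope ring_scope.

(** Let [G p q] be the sum of [s ^ ds la] over the partitions in a [p x q] box.
Deleting the first hook maps the partitions with exactly [p + 1] rows and
[q + 1] columns bijectively to those in a [p x q] box, and the deleted hook is
self-conjugate iff [p = q].  By inclusion-exclusion
  [G (p+1) (q+1) = G p (q+1) + G (p+1) q - G p q + s ^ [p = q] G p q].
So for [p <> q] this is Pascal's rule, and its solution is
  [G p q = the coefficient of z ^ min p q in C ^ |p - q| / D],
where [C = 1 + z C ^ 2] is the Catalan series and [D = (1 - s) z + sqrt (1-4z)].
The first formula is the case [p = q]; the partitions whose smallest enclosing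
square has side [n] contribute [G n n - G (n-1) (n-1)], whence the second. *)

Local Open Scope classical_set_scope.

(** * Deleting and restoring the first hook *)

Lemma intpart_nth_gt0 (s : seq nat) (i : nat) :
  is_intpart s -> (i < size s)%N -> (0 < nth 0%N s i)%N.
Proof. by move=> /andP[_ /allP s_gt0] lt_is; apply/s_gt0/mem_nth. Qed.

Definition unhook (la : intpart) : intpart :=
  IntPart (remove_hook_intpart (valP la)).

Lemma part_unhook (la : intpart) (i : nat) :
  (0 < i)%N -> part (unhook la) i = (part la i.+1).-1.
Proof.
by case: i => // i _; rewrite /part nth_remove_hook //; exact: valP.
Qed.

Lemma durfee_nil (la : intpart) : size la = 0%N -> durfee la = 0%N.
Proof. by rewrite /durfee => ->; rewrite big_geq. Qed.

(** Deleting the first hook shifts the main diagonal: its box [d + 1] becomes box [d]. *)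
Lemma durfee_unhook (la : intpart) :
  (0 < size la)%N -> durfee la = (durfee (unhook la)).+1.
Proof.
move=> la_gt0; apply/eqP; rewrite eqn_leq; apply/andP; split.
  case E: (durfee la) => [//|[//|d]]; rewrite ltnS durfee_max // part_unhook //.
  have: (d.+2 <= part la d.+2)%N by apply: durfee_le; rewrite E leqnn.
  by case: part.
apply: durfee_max => //; case E: (durfee (unhook la)) => [|d].
  by apply: intpart_nth_gt0 => //; exact: valP.
have: (d.+1 <= part (unhook la) d.+1)%N by apply: durfee_le; rewrite E leqnn.
by rewrite part_unhook //; case: part.
Qed.

Lemma ds_nil (la : intpart) : size la = 0%N -> ds la = 0%N.
Proof. by move=> la0; rewrite /ds durfee_nil // big_ord0. Qed.

Lemma ds_unhook (la : intpart) :
  (0 < size la)%N -> ds la = ((part la 1 == size la) + ds (unhook la))%N.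
Proof.
move=> la_gt0; rewrite /ds durfee_unhook // big_ord_recl /=; congr addn.
by apply: eq_bigr => i _; rewrite -iterS iterSr.
Qed.

Definition box (p q : nat) : set intpart :=
  [set la : intpart | (size la <= p)%N /\ (part la 1 <= q)%N].

Definition tight_box (p q : nat) : set intpart :=
  [set la : intpart | size la = p /\ part la 1 = q].

Lemma sub_box (p q p' q' : nat) :
  (p <= p')%N -> (q <= q')%N -> box p q `<=` box p' q'.
Proof.
by move=> pp' qq' la [lap laq]; split; [exact: leq_trans pp'|exact: leq_trans qq'].
Qed.

Lemma finite_box (p q : nat) : finite_set (box p q).
Proof.
apply: sub_finite_set (finite_boxed (maxn p q)).
by apply: sub_box; rewrite ?leq_maxl ?leq_maxr.
Qed.

(** Inverse of [unhook] on the [p x q] box. Past the last part of [s], the default [0] of [nth]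
    yields rows of length 1, which extend the first column to [p + 1] rows. *)
Definition add_hook (p q : nat) (s : seq nat) : seq nat :=
  mkseq (fun i => if i is j.+1 then (nth 0%N s j).+1 else q.+1) p.+1.

Lemma add_hook_intpart (p q : nat) (s : seq nat) :
  is_intpart s -> (nth 0%N s 0 <= q)%N -> is_intpart (add_hook p q s).
Proof.
move=> s_part le_q; apply/andP; split; last first.
  by apply/allP => x /mapP[[|i] _ ->].
have geq_trans : transitive geq by move=> a b c /= ab bc; apply: leq_trans bc ab.
rewrite sorted_map; apply: (@sub_sorted _ ltn); last exact: iota_ltn_sorted.
move=> [|i] [|j] //= lt_ij; rewrite ltnS; last first.
  by apply: nth_is_intpart => //; exact: ltnW.
by apply: leq_trans le_q; apply: nth_is_intpart.
Qed.

Lemma unhook_bij (p q : nat) :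
  set_bij (tight_box p.+1 q.+1) (box p q) unhook.
Proof.
split.
- move=> la [la_p la_q]; split.
    rewrite size_map size_filter (leq_trans (count_size _ _)) //.
    by rewrite size_behead la_p.
  rewrite part_unhook //.
  have : (part la 2 <= part la 1)%N by apply: nth_is_intpart => //; exact: valP.
  by rewrite la_q; case: part.
- move=> la mu; rewrite !inE => -[la_p la_q] [mu_p mu_q] /(congr1 val) eq_hk.
  apply/val_inj/(@eq_from_nth _ 0%N); rewrite /= la_p ?mu_p // => -[|i] lt_ip.
    by move: la_q mu_q; rewrite /part /= => -> ->.
  have := congr1 (nth 0%N ^~ i) eq_hk.
  rewrite /= !nth_remove_hook; try exact: valP.
  (* Both rows are nonempty, and [.-1] is injective on positive numbers. *)
  have : (0 < nth 0%N la i.+1)%N by apply: intpart_nth_gt0; rewrite ?la_p ?valP.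
  have : (0 < nth 0%N mu i.+1)%N by apply: intpart_nth_gt0; rewrite ?mu_p ?valP.
  by case: nth => // a _; case: nth => // b _ /= ->.
- move=> mu [mu_p mu_q]; have hk := add_hook_intpart p (valP mu) mu_q.
  exists (IntPart hk); first by split; rewrite /= ?size_map ?size_iota.
  apply/val_inj; rewrite /= /remove_hook /= (iotaDl 1 0) -map_comp.
  rewrite filter_map -map_comp /=.
  (* Of the restored rows below the first, [remove_hook] keeps those longer than 1, which are
     exactly those coming from a part of [mu]. *)
  rewrite (eq_filter (a2 := fun i => i < size mu)%N); last first.
    move=> i /=; rewrite ltnS; apply/idP/idP => [|lt_i].
      by apply: contraTT; rewrite -leqNgt => le_i; rewrite nth_default.
    by apply: intpart_nth_gt0 => //; exact: valP.
  have -> : [seq i <- iota 0 p | (i < size mu)%N] = iota 0 (size mu).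
    rewrite -{1}(subnKC mu_p) iotaD filter_cat (all_filterP _).
      rewrite (eq_in_filter (a2 := pred0)) ?filter_pred0 ?cats0 //.
      by move=> i; rewrite mem_iota add0n => /andP[le_i _]; apply/negbTE; rewrite -leqNgt.
    by apply/allP => i; rewrite mem_iota.
  exact: (mkseq_nth 0%N).
Qed.

(** * The recurrence for sums over boxes *)

Section BoxSum.
Variables (R : comNzRingType) (t : R).

Definition box_sum (p q : nat) : R := \sum_(la \in box p q) t ^+ ds la.

Lemma box_sum_empty (p q : nat) : (p == 0%N) || (q == 0%N) -> box_sum p q = 1.
Proof.
move=> pq0; have nil_part : is_intpart [::] by [].
have -> : 1 = t ^+ ds (IntPart nil_part) by rewrite ds_nil.
rewrite /box_sum -(fsbig_set1 +%R (IntPart nil_part) (fun la => t ^+ ds la)).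
congr (\big[_/_]_(_ \in _) _); apply/seteqP; split=> [la [la_p la_q]|_ ->] //.
apply/val_inj/size0nil/eqP; rewrite -leqn0; case/orP: pq0 => /eqP pq0.
  by rewrite -pq0.
rewrite leqNgt; apply/negP => la_gt0.
have := intpart_nth_gt0 (valP la) la_gt0.
by move: la_q; rewrite pq0 leqn0 /part /= => /eqP ->.
Qed.

Lemma tight_box_sum (p q : nat) :
  \sum_(la \in tight_box p.+1 q.+1) t ^+ ds la = t ^+ (p == q) * box_sum p q.
Proof.
have fin : finite_set (tight_box p.+1 q.+1).
  apply: sub_finite_set (finite_box p.+1 q.+1).
  by move=> la [la_p la_q]; split; rewrite ?la_p ?la_q.
rewrite /box_sum (reindex_fsbig unhook (tight_box p.+1 q.+1) (box p q)); last first.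
  exact: unhook_bij.
rewrite !fsbig_finite // big_distrr /=; apply: eq_big_seq => la.
rewrite in_fset_set // inE => -[la_p la_q].
by rewrite ds_unhook la_p // la_q eqSS eq_sym exprD.
Qed.

Lemma box_sum_rec (p q : nat) :
  box_sum p.+1 q.+1 =
  box_sum p q.+1 + box_sum p.+1 q + (t ^+ (p == q) - 1) * box_sum p q.
Proof.
pose short := [set la : intpart | (size la <= p)%N].
pose narrow := [set la : intpart | (part la 1 <= q)%N].
have short_box q' : box p.+1 q' `&` short = box p q'.
  apply/seteqP; split=> [la [[_ la_q] la_p]|la [la_p la_q]] //.
  by do 2!split => //; apply: leqW.
have narrow_box : box p.+1 q.+1 `&` ~` short `&` narrow
                  = box p.+1 q `&` ~` short.
  apply/seteqP; split=> [la [[[la_p _] la_s] la_q]|la [[la_p la_q] la_s]] //.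
  by do 3!split => //; apply: leqW.
have tight : box p.+1 q.+1 `&` ~` short `&` ~` narrow = tight_box p.+1 q.+1.
  rewrite /short /narrow; apply/seteqP.
  split=> [la [[[la_p la_q] /= /negP la_s] /negP la_n]|la [la_p la_q]].
    by split; apply/eqP; rewrite eqn_leq ?la_p ?la_q ltnNge.
  by split; [split; [split|]|]; rewrite /= ?la_p ?la_q // ltnn.
have fin q' : finite_set (box p.+1 q' `&` ~` short).
  by apply/finite_setIl/finite_box.
(* The partitions with [p + 1] rows and first part at most [q] sum to [G (p+1) q - G p q]; the
   others with [p + 1] rows form the tight box. *)
rewrite /box_sum (fsbigID short (box p.+1 q.+1)); last exact: finite_box.
rewrite (fsbigID short (box p.+1 q)); last exact: finite_box.
rewrite (fsbigID narrow (box p.+1 q.+1 `&` ~` short)) //.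
rewrite !short_box narrow_box tight tight_box_sum /box_sum /=; ring.
Qed.

End BoxSum.

(** * The Catalan series and the solution of the recurrence *)

Section Catalan.
Variables (R : comUnitRingType) (t : R).
Hypothesis U2 : (2%:R : R) \is a GRing.unit.

Local Notation z := (fpsX R).
Local Notation r := (fps_sqrt (1 - 4%:R * z)).
Local Notation D := ((1 - fpsC t) * z + r).

Lemma fps_coefXM0 (f : fps R) : (z * f) 0%N = 0.
Proof. by rewrite fps_coefM0 mul0r. Qed.

Lemma fps_coefXMS (f : fps R) (n : nat) : (z * f) n.+1 = f n.
Proof.
rewrite fps_coefM big_ord_recl mul0r add0r big_ord_recl mul1r subSS subn0.
by rewrite big1 ?addr0 // => i _; rewrite mul0r.
Qed.

(** Although [z] is not a unit, it can be cancelled, since multiplying by it only shifts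
    coefficients. *)
Lemma fps_mulXI : injective ( *%R z : fps R -> fps R).
Proof.
move=> f g eq_zfg; apply/fpsP => n.
by rewrite -(fps_coefXMS f) -(fps_coefXMS g) eq_zfg.
Qed.

Lemma fps_unit2 : (2%:R : fps R) \is a GRing.unit.
Proof. by rewrite fps_unitE. Qed.

Lemma sqrt_1_4z : r ^+ 2 = 1 - 4%:R * z /\ r 0%N = 1.
Proof.
apply: fps_sqrtP => //.
by rewrite fps_coefD fps_coefN fps_coefM0 mulr0 subr0.
Qed.

(** This is [(1 - r) / (2 z)]; the index shift divides by [z], exactly because [1 - r] has constant
    term [0]. *)
Definition catalan : fps R := Fps (fun n => (2%:R^-1 * (1 - r)) n.+1).

Lemma sqrt_catalan : r = 1 - 2%:R * (z * catalan).
Proof.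
have -> : z * catalan = 2%:R^-1 * (1 - r).
  apply/fpsP => -[|n]; rewrite ?fps_coefXMS // fps_coefXM0 fps_coefM0.
  by rewrite fps_coefD fps_coefN sqrt_1_4z.2 subrr mulr0.
by rewrite mulVKr ?fps_unit2 // subKr.
Qed.

Lemma catalan_eq : catalan = 1 + z * catalan ^+ 2.
Proof.
(* Squaring [r = 1 - 2 z C] gives [4 z (C - 1 - z C ^ 2) = 0], from which [z] and twice the unit [2]
   are cancelled. *)
have := sqrt_1_4z.1; rewrite sqrt_catalan => /eqP.
rewrite -subr_eq0 => /eqP zC0; apply/eqP; rewrite -subr_eq0; apply/eqP/fps_mulXI.
apply: (mulrI fps_unit2); apply: (mulrI fps_unit2); rewrite !mulr0 -oppr0 -zC0.
by ring.
Qed.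

Lemma catalan0 : catalan 0%N = 1.
Proof. by rewrite catalan_eq fps_coefD fps_coefXM0 addr0. Qed.

Lemma D_unit : D \is a GRing.unit.
Proof. exact: denominator_unit. Qed.

(** For [t = 1] the coefficient of [z ^ n] is the binomial coefficient of [2 n + h] over [n], which
    counts the partitions in an [n x (n + h)] box. *)
Definition ballot (h : nat) : fps R := catalan ^+ h / D.

Lemma ballot0 (h : nat) : ballot h 0%N = 1.
Proof.
have C0 : (catalan ^+ h) 0%N = 1.
  by elim: h => // h IHh; rewrite exprS fps_coefM0 catalan0 IHh mulr1.
have D0 : D 0%N = 1 by rewrite fps_coefD sqrt_1_4z.2 mulrC fps_coefXM0 add0r.
by rewrite -C0 -[in RHS](divrK D_unit (catalan ^+ h)) [RHS]fps_coefM0 D0 mulr1.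
Qed.

Lemma ballot_diag (n : nat) :
  ballot 0 n.+1 = ballot 1 n + ballot 1 n + (t - 1) * ballot 0 n.
Proof.
(* Divide [1 = D + z (2 C + t - 1)] by [D]. *)
have b0E : ballot 0 = 1 + z * (ballot 1 + ballot 1 + (fpsC t - 1) * ballot 0).
  have b0 : ballot 0 * D = 1 by rewrite /ballot divrK ?D_unit.
  have b1 : ballot 1 * D = catalan by rewrite /ballot divrK ?D_unit.
  apply: (mulIr D_unit); rewrite b0.
  transitivity (D + z * (ballot 1 * D + ballot 1 * D
                         + (fpsC t - 1) * (ballot 0 * D))); last by ring.
  by rewrite b0 b1 sqrt_catalan; ring.
rewrite {1}b0E fps_coefD fps_coefXMS fps_coef1 add0r !fps_coefD; congr (_ + _).
by rewrite mulrBl [LHS]fps_coefD fps_coefN fps_coefCM mul1r mulrBl mul1r.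
Qed.

(** Multiply [C = 1 + z C ^ 2] by [C ^ h / D]. *)
Lemma ballot_pascal (h n : nat) :
  ballot h.+1 n.+1 = ballot h.+2 n + ballot h n.+1.
Proof.
have -> : ballot h.+1 = z * ballot h.+2 + ballot h.
  by rewrite /ballot mulrA -mulrDl exprS {1}catalan_eq !exprS; congr (_ / _); ring.
by rewrite fps_coefD fps_coefXMS.
Qed.

(** Truncated subtraction makes [(p - q) + (q - p)] the distance [|p - q|]. Induction on [p], then
    on [q], matches [box_sum_rec] with [ballot_pascal] off the diagonal and with [ballot_diag] on
    it. *)
Lemma box_sumE (p q : nat) :
  box_sum t p q = ballot ((p - q) + (q - p)) (minn p q).
Proof.
elim: p q => [|p IHp] q; first by rewrite box_sum_empty // min0n ballot0.
elim: q => [|q IHq]; first by rewrite box_sum_empty ?orbT // minn0 ballot0.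
rewrite box_sum_rec IHq !IHp; case: (ltngtP p q) => [lt_pq|lt_qp|->].
(* With [h = q - p - 1], the boxes [(p+1) x (q+1)], [p x (q+1)] and [(p+1) x q] have side
   differences [h + 1], [h + 2] and [h]. *)
- rewrite expr0 subrr mul0r addr0.
  have -> : (p.+1 - q.+1 + (q.+1 - p.+1) = (q - p.+1).+1)%N by lia.
  have -> : (p - q.+1 + (q.+1 - p) = (q - p.+1).+2)%N by lia.
  have -> : (p.+1 - q + (q - p.+1) = q - p.+1)%N by lia.
  have -> : minn p.+1 q.+1 = p.+1 by lia.
  have -> : minn p q.+1 = p by lia.
  have -> : minn p.+1 q = p.+1 by lia.
  by rewrite ballot_pascal.
- rewrite expr0 subrr mul0r addr0 addrC.
  have -> : (p.+1 - q.+1 + (q.+1 - p.+1) = (p - q.+1).+1)%N by lia.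
  have -> : (p.+1 - q + (q - p.+1) = (p - q.+1).+2)%N by lia.
  have -> : (p - q.+1 + (q.+1 - p) = p - q.+1)%N by lia.
  have -> : minn p.+1 q.+1 = q.+1 by lia.
  have -> : minn p.+1 q = q by lia.
  have -> : minn p q.+1 = q.+1 by lia.
  by rewrite ballot_pascal.
- rewrite expr1 !subnn !minnn addn0 ballot_diag.
  have -> : (q - q.+1 + (q.+1 - q) = 1)%N by lia.
  have -> : (q.+1 - q + (q - q.+1) = 1)%N by lia.
  have -> : minn q q.+1 = q by lia.
  by have -> : minn q.+1 q = q by lia.
Qed.

End Catalan.

(** * Extraction of coefficients and the two generating functions *)

Lemma fps_coefCXn (R : comNzRingType) (c : R) (d m n : nat) :
  (fpsC c ^+ d * fpsX R ^+ m) n = if n == m then c ^+ d else 0.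
Proof.
elim: d => [|d IHd]; first by rewrite expr0 mul1r fps_coefXn; case: eqP.
by rewrite exprS -mulrA fps_coefCM IHd exprS; case: ifP; rewrite ?mulr0.
Qed.

Lemma fps_coef_fsum (R : comNzRingType) (I : choiceType) (P : set I)
    (F : I -> fps R) (n : nat) :
  finite_set P -> (\sum_(i \in P) F i) n = \sum_(i \in P) F i n.
Proof.
move=> finP; rewrite !fsbig_finite //.
by elim/big_rec2: _ => //= i a b _ <-.
Qed.

Section GeneratingFunctions.
Variables (R : comUnitRingType) (t : R).
Hypothesis U2 : (2%:R : R) \is a GRing.unit.

Local Notation s := (fpsC t).
Local Notation z := (fpsX R).
Local Notation D := ((1 - s) * z + fps_sqrt (1 - 4%:R * z)).

Lemma coef_inv_D (n : nat) : (1 / D) n = box_sum t n n.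
Proof. by rewrite box_sumE // subnn minnn /ballot expr0. Qed.

Lemma boxed_gf :
  fps_sum (fun n : nat => \sum_(la \in boxed n) s ^+ ds la * z ^+ n) = 1 / D.
Proof.
apply/fpsP => m; rewrite coef_inv_D /=.
pose F (n : nat) : R := (\sum_(la \in boxed n) s ^+ ds la * z ^+ n : fps R) m.
(* The inner sum for [n] is a constant times [z ^ n], so only [n = m] contributes. *)
have FE n : F n = if m == n then box_sum t n n else 0.
  rewrite /F fps_coef_fsum; last exact: finite_boxed.
  under eq_fsbigr do rewrite fps_coefCXn.
  by case: eqP => // _; rewrite fsbig1.
transitivity (\sum_(n \in [set m]) F n); last by rewrite fsbig_set1 FE eqxx.
apply/esym/fsbig_widen => // n [_ /eqP ne_nm]; rewrite /= -/(F n) FE.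
by rewrite eq_sym (negPf ne_nm).
Qed.

Lemma square_gf :
  fps_sum (fun la : intpart =>
      s ^+ ds la * z ^+ maxn (part la 1) (conj_part la 1)) = (1 - z) / D.
Proof.
apply/fpsP => n.
pose F (la : intpart) : R :=
  if n == maxn (part la 1) (size la) then t ^+ ds la else 0.
have FE la : (s ^+ ds la * z ^+ maxn (part la 1) (conj_part la 1)) n = F la.
  by rewrite fps_coefCXn conj_part1.
transitivity (\sum_(la \in [set: intpart]) F la).
  by apply: eq_fsbigr => la _; exact: FE.
(* A partition outside the [n x n] box has a smallest enclosing square of side greater than [n]. *)
transitivity (\sum_(la \in box n n) F la).
  apply/esym/fsbig_widen => // la [_ /= nbox]; rewrite /F; case: eqP => // max_la.
  by case: nbox; split; rewrite max_la ?leq_maxl ?leq_maxr.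
rewrite -[1 - z]mulr1 -mulrA mulrBl !mul1r -[D^-1]mul1r fps_coefD fps_coefN.
rewrite coef_inv_D; case: n @F FE => [|n] F _.
  rewrite fps_coefXM0 subr0; apply: eq_fsbigr => la; rewrite inE => -[la_p la_q].
  by rewrite /F eq_sym -leqn0 geq_max la_p la_q.
(* In the box of side [n + 1], the terms [F la] vanish inside the box of side [n]; all other
   partitions there have smallest side exactly [n + 1]. *)
rewrite fps_coefXMS coef_inv_D; apply/esym/eqP; rewrite subr_eq; apply/eqP.
have box_n : box n.+1 n.+1 `&` box n n = box n n.
  by apply/setIidPr/sub_box.
rewrite /box_sum (fsbigID (box n n) (box n.+1 n.+1)); last exact: finite_box.
rewrite box_n addrC; congr (_ + _).
rewrite [RHS](fsbigID (box n n)); last exact: finite_box.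
rewrite box_n [X in _ = X + _]fsbig1 ?add0r => [|la [la_p la_q]]; last first.
  by rewrite /F gtn_eqF // ltnS geq_max la_p la_q.
apply: eq_fsbigr => la; rewrite inE => -[[la_p la_q] /= nbox].
rewrite /F ifT // eqn_leq geq_max la_p la_q.
by rewrite ltnNge geq_max !andbT; apply/negP => /andP[le_q le_p]; apply: nbox.
Qed.

End GeneratingFunctions.

Theorem proposition4p7 :
  let s : fps {poly rat} := fpsC 'X in
  let z : fps {poly rat} := fpsX {poly rat} in
  fps_sum (fun n : nat => \sum_(la \in boxed n) s ^+ ds la * z ^+ n)
    = 1 / ((1 - s) * z + fps_sqrt (1 - 4%:R * z))
  /\
  fps_sum (fun la : intpart =>
      s ^+ ds la * z ^+ maxn (part la 1) (conj_part la 1))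
    = (1 - z) / ((1 - s) * z + fps_sqrt (1 - 4%:R * z)).
Proof.
(* Halving, on which the square root rests, is possible in [{poly rat}]. *)
have U2 : (2%:R : {poly rat}) \is a GRing.unit.
  by rewrite -polyC_natr poly_unitE size_polyC coefC.
by move=> s z; split; [exact: boxed_gf | exact: square_gf].
Qed.
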